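(* Let $X\subset\mathbb{R}^d$ be a finite set with $N$ points, $\mathcal H=\mathbb{R}^X\cong\mathbb{R}^N$ with the Euclidean inner product, and let $Q_1,\dots,Q_n:\mathcal H\to\mathcal H$ be deterministic linear operators with multiscale approximation operators $M_j$. Let $f\in\mathcal H$, $Y=f+\varepsilon$ with $\mathbb{E}[\varepsilon]=0$ and $\operatorname{Cov}(\varepsilon)=\sigma^2I$, and $\widetilde f_j=M_jY$. Suppose that $Q_1,\dots,Q_n$ share an orthonormal eigenbasis $\{u_k\}_{k=1}^N$ of $\mathcal H$ with $Q_iu_k=\lambda_{i,k}u_k$, $0\le\lambda_{i,k}\le1$; let $f=\sum_{k=1}^N\theta_ku_k$ and $a_{j,k}=\prod_{i=1}^j(1-\lambda_{i,k})$. Then, for $1\le j\le n-1$, the level-$(j+1)$ increment of the integrated error decomposes over modes as $$\operatorname{MISE}_{j+1}-\operatorname{MISE}_j=\sum_{k=1}^N\Delta_{j,k},\qquad \Delta_{j,k}=a_{j,k}\,\lambda_{j+1,k}\Bigl[2\sigma^2-a_{j,k}(2-\lambda_{j+1,k})(\theta_k^2+\sigma^2)\Bigr],$$ where $\Delta_{j,k}=m_{j+1,k}-m_{j,k}$ is the increment of the error contribution $m_{j,k}=a_{j,k}^2\theta_k^2+\sigma^2(1-a_{j,k})^2$ of mode $k$. Consequently, for each $k$ with $\theta_k^2+\sigma^2>0$, adding level $j+1$ strictly decreases the error contributed by mode $k$ (that is, $\Delta_{j,k}<0$) if and only if $a_{j,k}\lambda_{j+1,k}>0$ and $$a_{j,k}(2-\lambda_{j+1,k})>\frac{2\sigma^2}{\theta_k^2+\sigma^2}.\qquad(\ast)$$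 In particular: (i) If $\sigma=0$, then $\Delta_{j,k}\le0$ for all $j,k$, so $\operatorname{MISE}_j$ is nonincreasing in $j$. (ii) Once $a_{j,k}<\sigma^2/(\theta_k^2+\sigma^2)$, the criterion $(\ast)$ fails at that level and at every subsequent level (i.e. with $j$ replaced by any $j'\ge j$), and the error contribution of mode $k$ is then nondecreasing under subsequent levels (i.e. $\Delta_{j',k}\ge0$ for all $j'\ge j$).
   Context: The data sites $X$ and the level operators are fixed; $\mathbb{E}$ is the expectation with respect to the noise $\varepsilon$ only. Multiscale recursion: $M_0=0$, $E_0=I$, and for $i=1,\dots,n$: $M_if=M_{i-1}f+Q_iE_{i-1}f$, $E_if=E_{i-1}f-Q_iE_{i-1}f$. The integrated error after $j$ levels is $\operatorname{MISE}_j=\sum_{x\in X}\mathbb{E}[(f(x)-\widetilde f_j(x))^2]$ (no normalization). The number $\lambda_{j+1,k}$ is the spectral response of level $j+1$ on mode $k$, so $a_{j+1,k}=(1-\lambda_{j+1,k})a_{j,k}$. *)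

(* Defs.v *)
From HB Require Import structures.
From mathcomp Require Import all_boot all_order all_algebra.
From mathcomp Require Import finmap.
From mathcomp Require Import all_classical all_reals all_analysis.

Set Implicit Arguments.
Unset Strict Implicit.
Unset Printing Implicit Defensive.

Import Order.TTheory GRing.Theory Num.Theory.

Local Open Scope ring_scope.

(* R^o rather than R: this is what makes the finite functions X -> R a vector
   space over R, with {vspace}, basis_of and 'End available. *)
Notation data_space R X := {ffun X -> R^o}.

Definition dot (R : realType) (X : finType) (g h : data_space R X) : R :=
  \sum_(x : X) g x * h x.

Definition orthonormal_basis (R : realType) (X : finType) (N : nat)
    (u : 'I_N -> data_space R X) : Prop :=
  (forall k l : 'I_N, dot (u k) (u l) = (k == l)%:R) /\
  basis_of fullv [tuple u k | k < N].

(* The level operators are indexed from 1: ms_error Q j and ms_approx Q j only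
   involve Q 1, ..., Q j, and the value Q 0 is never used. *)
Fixpoint ms_error (R : realType) (X : finType)
    (Q : nat -> 'End(data_space R X)) (j : nat) : 'End(data_space R X) :=
  if j is i.+1 then ms_error Q i - (Q i.+1 \o ms_error Q i)%VF else \1%VF.

Fixpoint ms_approx (R : realType) (X : finType)
    (Q : nat -> 'End(data_space R X)) (j : nat) : 'End(data_space R X) :=
  if j is i.+1 then ms_approx Q i + (Q i.+1 \o ms_error Q i)%VF else 0.

Definition noisy_data (R : realType) (X : finType) (T : Type)
    (f : data_space R X) (eps : X -> T -> R) (w : T) : data_space R X :=
  [ffun x => f x + eps x w].

(* Extended-real valued, since no integrability is built into 'E_P[_]. *)
Definition MISE (R : realType) (dT : measure_display) (T : measurableType dT)
    (P : probability T R) (X : finType) (Q : nat -> 'End(data_space R X))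
    (f : data_space R X) (eps : X -> T -> R) (j : nat) : \bar R :=
  (\sum_(x : X)
     'E_P[(fun w => (f x - ms_approx Q j (noisy_data f eps w) x) ^+ 2)%R])%E.

Definition damping (R : realType) (N : nat) (lam : nat -> 'I_N -> R)
    (j : nat) (k : 'I_N) : R :=
  \prod_(1 <= i < j.+1) (1 - lam i k).

Definition mode_error (R : realType) (N : nat) (lam : nat -> 'I_N -> R)
    (theta : 'I_N -> R) (sigma : R) (j : nat) (k : 'I_N) : R :=
  damping lam j k ^+ 2 * theta k ^+ 2 + sigma ^+ 2 * (1 - damping lam j k) ^+ 2.

Definition mode_increment (R : realType) (N : nat) (lam : nat -> 'I_N -> R)
    (theta : 'I_N -> R) (sigma : R) (j : nat) (k : 'I_N) : R :=
  damping lam j k * lam j.+1 k *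
    (2 * sigma ^+ 2 -
     damping lam j k * (2 - lam j.+1 k) * (theta k ^+ 2 + sigma ^+ 2)).

(* Meaningful only when theta k ^+ 2 + sigma ^+ 2 > 0. *)
Definition level_criterion (R : realType) (N : nat) (lam : nat -> 'I_N -> R)
    (theta : 'I_N -> R) (sigma : R) (j : nat) (k : 'I_N) : Prop :=
  damping lam j k * (2 - lam j.+1 k) >
    2 * sigma ^+ 2 / (theta k ^+ 2 + sigma ^+ 2).

(* Main.v *)
Require Import Defs.
From HB Require Import structures.
From mathcomp Require Import all_boot all_order all_algebra.
From mathcomp Require Import finmap.
From mathcomp Require Import all_classical all_reals all_analysis.
From mathcomp Require Import ring lra.

Import Order.TTheory GRing.Theory Num.Theory.

Local Open Scope ring_scope.

(** Write the noise in the eigenbasis as [eps = \sum_k e_k u_k].  The error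
    operator [E_j] acts on mode [k] as multiplication by the damping
    [a_(j,k)], and [M_j + E_j = I], so the residual [f - M_j Y] has
    coefficients [a_(j,k) theta_k - (1 - a_(j,k)) e_k].  White noise stays white
    in an orthonormal basis, and Parseval's identity turns the sum over the
    sites into a sum over the modes:
    [MISE_j = \sum_k (a_(j,k)^2 theta_k^2 + sigma^2 (1 - a_(j,k))^2)]
    ([MISE_mode_error]).

    In the proof the expectation is taken site by site: at the site [x] the
    residual is a constant minus a linear combination of the noise values, whose
    mean square is given by [expectation_affine_sqr]; the sum over the sites of
    the constant parts is evaluated by [parseval], that of the noise parts by
    [sum_kernel_sqr].  The linearity of the expectation is available because a
    finite second moment puts the noise in [L^2] ([noise_Lfun2]).

    Since [a_(j+1,k) = (1 - lam_(j+1,k)) a_(j,k)], the increment of a mode error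
    is a polynomial identity, and its sign is that of its bracket whenever
    [a_(j,k) lam_(j+1,k) > 0].  The dampings lie in [0, 1] and do not increase
    with the level, so that a mode damped below
    [sigma^2 / (theta_k^2 + sigma^2)] satisfies
    [a (2 - lam) <= 2 a < 2 sigma^2 / (theta_k^2 + sigma^2)] at every later
    level. *)

(** * Orthonormal bases of the data space *)

Lemma dotC (R : realType) (X : finType) (g h : data_space R X) :
  dot g h = dot h g.
Proof. by apply: eq_bigr => x _; rewrite mulrC. Qed.

Lemma dot_suml (R : realType) (X : finType) (I : finType) (c : I -> R)
    (v : I -> data_space R X) (h : data_space R X) :
  dot (\sum_i c i *: v i) h = \sum_i c i * dot (v i) h.
Proof.
rewrite /dot; under eq_bigr => x _ do rewrite sum_ffunE mulr_suml.
rewrite exchange_big; apply: eq_bigr => i _.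
by rewrite mulr_sumr; apply: eq_bigr => x _; rewrite ffunE mulrA.
Qed.

Section OrthonormalBasis.
Context {R : realType} {X : finType} {N : nat}.
Variable (u : 'I_N -> data_space R X).
Hypothesis hu : orthonormal_basis u.

Lemma dot_coord (c : 'I_N -> R) (k : 'I_N) :
  dot (\sum_l c l *: u l) (u k) = c k.
Proof.
rewrite dot_suml (bigD1 k)//= hu.1 eqxx mulr1 big1 ?addr0// => l lk.
by rewrite hu.1 (negbTE lk) mulr0.
Qed.

Lemma parseval (c : 'I_N -> R) :
  \sum_(x : X) ((\sum_k c k *: u k) x) ^+ 2 = \sum_k c k ^+ 2.
Proof.
transitivity (dot (\sum_k c k *: u k) (\sum_k c k *: u k)).
  by apply: eq_bigr => x _; rewrite expr2.
rewrite dot_suml; apply: eq_bigr => k _.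
by rewrite dotC dot_coord expr2.
Qed.

Lemma orthonormal_expansion (g : data_space R X) :
  g = \sum_k dot g (u k) *: u k.
Proof.
have [_ ub] := hu.
pose c k := coord [tuple u k | k < N] k g.
have gE : g = \sum_k c k *: u k.
  rewrite {1}(coord_basis ub (memvf g)); apply: eq_bigr => k _.
  by rewrite -tnth_nth tnth_mktuple.
by rewrite {1}gE; apply: eq_bigr => k _; congr (_ *: _); rewrite {1}gE dot_coord.
Qed.

(** Squared Hilbert-Schmidt norm of the operator that is diagonal in [u] with
    eigenvalues [b]. *)
Lemma sum_kernel_sqr (b : 'I_N -> R) :
  \sum_(x : X) \sum_(y : X) (\sum_k b k * u k y * u k x) ^+ 2 =
  \sum_k b k ^+ 2.
Proof.
rewrite exchange_big.
transitivity (\sum_(y : X) \sum_k (b k * u k y) ^+ 2).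
  apply: eq_bigr => y _; rewrite -parseval; apply: eq_bigr => x _.
  by rewrite sum_ffunE; congr (_ ^+ 2); apply: eq_bigr => k _; rewrite ffunE.
rewrite exchange_big; apply: eq_bigr => k _.
under eq_bigr => y _ do rewrite exprMn.
rewrite -mulr_sumr -[RHS]mulr1; congr (_ * _).
by transitivity (dot (u k) (u k)); [apply: eq_bigr => y _; rewrite expr2
  |rewrite hu.1 eqxx].
Qed.

End OrthonormalBasis.

(** * Multiscale operators on a common eigenbasis *)

Section Multiscale.
Context {R : realType} {X : finType}.
Variable (Q : nat -> 'End(data_space R X)).

Lemma ms_approx_add_error (j : nat) (g : data_space R X) :
  ms_approx Q j g + ms_error Q j g = g.
Proof.
elim: j => [|j IH] /=; first by rewrite zero_lfunE add0r id_lfunE.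
by rewrite !add_lfunE opp_lfunE addrACA subrr addr0.
Qed.

Context {N n : nat}.
Variables (u : 'I_N -> data_space R X) (lam : nat -> 'I_N -> R).
Hypothesis Qu : forall i k, (1 <= i <= n)%N -> Q i (u k) = lam i k *: u k.

Lemma dampingS (j : nat) (k : 'I_N) :
  damping lam j.+1 k = (1 - lam j.+1 k) * damping lam j k.
Proof. by rewrite /damping big_nat_recr//= mulrC. Qed.

Lemma ms_error_eigen (j : nat) (k : 'I_N) : (j <= n)%N ->
  ms_error Q j (u k) = damping lam j k *: u k.
Proof.
elim: j => [|j IH] jn /=.
  by rewrite /damping big_geq// id_lfunE scale1r.
have QZ a : Q j.+1 (a *: u k) = a *: Q j.+1 (u k) by exact: linearZZ.
rewrite add_lfunE opp_lfunE comp_lfunE (IH (ltnW jn)) QZ (Qu j.+1 k jn).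
by rewrite dampingS mulrBl mul1r scalerBl scalerA [lam _ _ * _]mulrC.
Qed.

Hypothesis hu : orthonormal_basis u.

Lemma ms_approx_spectral (j : nat) (g : data_space R X) : (j <= n)%N ->
  ms_approx Q j g = g - \sum_k (damping lam j k * dot g (u k)) *: u k.
Proof.
move=> jn; rewrite -{2}(ms_approx_add_error j g) -addrA.
suff -> : ms_error Q j g = \sum_k (damping lam j k * dot g (u k)) *: u k.
  by rewrite subrr addr0.
rewrite [in LHS](orthonormal_expansion u hu g) linear_sum.
apply: eq_bigr => k _.
have EZ a : ms_error Q j (a *: u k) = a *: ms_error Q j (u k).
  exact: linearZZ.
rewrite -[LHS]/(ms_error Q j (dot g (u k) *: u k)) EZ (ms_error_eigen _ _ jn).
by rewrite scalerA mulrC.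
Qed.

(** The residual at a site splits into a deterministic bias and the response to
    the noise, written with its kernel in the noise values at the sites. *)
Lemma ms_residual (j : nat) (theta : 'I_N -> R) (T : Type) (eps : X -> T -> R)
    (w : T) (x : X) : (j <= n)%N ->
  let f := \sum_k theta k *: u k in
  f x - ms_approx Q j (noisy_data f eps w) x =
  (\sum_k (damping lam j k * theta k) *: u k) x -
  \sum_y (\sum_k (1 - damping lam j k) * u k y * u k x) * eps y w.
Proof.
move=> jn f; pose e : data_space R X := [ffun y => eps y w].
have coordY k : dot (noisy_data f eps w) (u k) = theta k + dot e (u k).
  rewrite -(dot_coord u hu theta k) -big_split/=; apply: eq_bigr => y _.
  by rewrite !ffunE mulrDl.
have eE : eps x w = \sum_k dot e (u k) * u k x.
  transitivity (e x); first by rewrite ffunE.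
  rewrite {1}(orthonormal_expansion u hu e) sum_ffunE.
  by apply: eq_bigr => k _; rewrite ffunE.
rewrite (ms_approx_spectral _ _ jn) !ffunE !sum_ffunE eE.
under [X in _ = _ - X]eq_bigr => y _ do rewrite mulr_suml.
rewrite exchange_big/=.
have -> : \sum_k \sum_y (1 - damping lam j k) * u k y * u k x * eps y w =
    \sum_k (1 - damping lam j k) * dot e (u k) * u k x.
  apply: eq_bigr => k _.
  rewrite /dot mulr_sumr mulr_suml; apply: eq_bigr => y _; rewrite ffunE; ring.
have cancel (a b c : R) : a - (a + b - c) = c - b by ring.
rewrite cancel -!sumrB; apply: eq_bigr => k _.
(* The scaling of [R^o] unfolds to the product of [R]. *)
by rewrite !ffunE coordY /GRing.scale/=; ring.
Qed.

End Multiscale.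

(** * Second moments under white noise *)

Section Expectation.
Context {R : realType} {dT : measure_display} {T : measurableType dT}.
Variable (P : probability T R).

Lemma expectation_lincomb (I : Type) (r : seq I) (c : I -> R)
    (Z : I -> T -> R) : (forall i, Z i \in Lfun P 1) ->
  (fun w => \sum_(i <- r) c i * Z i w) \in Lfun P 1 /\
  ('E_P[(fun w => \sum_(i <- r) c i * Z i w)%R] =
   \sum_(i <- r) (c i)%:E * 'E_P[Z i])%E.
Proof.
move=> Z1; elim: r => [|i r [IH1 IH2]].
  have -> : (fun w => \sum_(i <- [::]) c i * Z i w) = cst (0 : R).
    by apply/funext => w; rewrite big_nil.
  by split; [exact: Lfun_cst | rewrite big_nil expectation_cst].
have -> : (fun w => \sum_(i <- i :: r) c i * Z i w) =
    c i \o* Z i \+ (fun w => \sum_(i <- r) c i * Z i w).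
  by apply/funext => w; rewrite big_cons/= mulrC.
have cZ1 : c i \o* Z i \in Lfun P 1 by exact: Lfun_scale.
split; first by rewrite rpredD.
by rewrite expectationD// big_cons expectationZl// IH2.
Qed.

Lemma Lfun2_expectation_sqr (Z : {RV P >-> R}) :
  ('E_P[(fun w => Z w ^+ 2)%R] < +oo)%E -> (Z : T -> R) \in Lfun P 2%:E.
Proof.
rewrite unlock => Zoo; rewrite inE; apply/andP; split; rewrite inE//=.
rewrite /finite_norm unlock poweR_lty//.
apply: le_lt_trans Zoo; rewrite le_eqVlt; apply/orP; left; apply/eqP.
apply: eq_integral => w _.
by rewrite /= powR_mulrn// real_normK// num_real.
Qed.

Section WhiteNoise.
Context {X : finType}.
Variables (eps : X -> {RV P >-> R}) (sigma : R).
Hypothesis eps_mean : forall x : X, ('E_P[eps x] = 0)%E.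
Hypothesis eps_cov : forall x y : X,
  covariance P (eps x) (eps y) = (if x == y then sigma ^+ 2 else 0)%:E.

(** The noise is centered, so its covariances are the expectations of the
    products; no integrability is needed for this. *)
Lemma expectation_noise_prod (x y : X) :
  ('E_P[(fun w => eps x w * eps y w)%R] =
   (if x == y then sigma ^+ 2 else 0)%:E)%E.
Proof.
rewrite -eps_cov covariance.unlock !eps_mean/=; congr expectation.
by apply/funext => w; rewrite !fctE/= !subr0.
Qed.

(** The variance is finite, which is what makes the noise square-integrable:
    the expectation of a random variable is defined without integrability. *)
Lemma noise_Lfun2 (x : X) : (eps x : T -> R) \in Lfun P 2%:E.
Proof.
apply: Lfun2_expectation_sqr.
have -> : (fun w => eps x w ^+ 2) = (fun w => eps x w * eps x w).
  by apply/funext => w; rewrite expr2.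
by rewrite expectation_noise_prod ltry.
Qed.

Lemma expectation_affine_sqr (c : R) (b : X -> R) :
  ('E_P[(fun w => (c - \sum_y b y * eps y w) ^+ 2)%R] =
   (c ^+ 2 + sigma ^+ 2 * \sum_y b y ^+ 2)%:E)%E.
Proof.
have eps1 x : (eps x : T -> R) \in Lfun P 1.
  exact: Lfun_subset12 (fin_num_measure P _ measurableT) _ (noise_Lfun2 x).
have [L1 E1] := expectation_lincomb _ (index_enum X) (fun y => - 2 * c * b y)
  (fun y => eps y : T -> R) eps1.
have [L2 E2] := expectation_lincomb _ (index_enum (X * X)%type)
  (fun p => b p.1 * b p.2) (fun p w => eps p.1 w * eps p.2 w)
  (fun p => Lfun2_mul_Lfun1 (noise_Lfun2 p.1) (noise_Lfun2 p.2)).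
have -> : (fun w => (c - \sum_y b y * eps y w) ^+ 2) =
   cst (c ^+ 2) \+ (fun w => \sum_y (- 2 * c * b y) * eps y w)
   \+ (fun w => \sum_p (b p.1 * b p.2) * (eps p.1 w * eps p.2 w)).
  apply/funext => w /=.
  have -> : \sum_y (- 2 * c * b y) * eps y w =
      - 2 * c * \sum_y b y * eps y w.
    by rewrite mulr_sumr; apply: eq_bigr => y _; ring.
  have -> : \sum_p (b p.1 * b p.2) * (eps p.1 w * eps p.2 w) =
      (\sum_y b y * eps y w) ^+ 2.
    rewrite expr2 mulr_suml.
    under [RHS]eq_bigr => y _ do rewrite mulr_sumr.
    rewrite pair_big/=; apply: eq_bigr => p _; ring.
  ring.
have Lc : cst (c ^+ 2) \in Lfun P 1 by exact: Lfun_cst.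
rewrite expectationD//; last by rewrite rpredD.
rewrite expectationD// expectation_cst E1 E2 [X in (_ + X + _)%E]big1; last first.
  by move=> y _; rewrite eps_mean mule0.
rewrite adde0 EFinD; congr (_ + _)%E.
transitivity (\sum_(p : X * X)
    (b p.1 * b p.2 * (if p.1 == p.2 then sigma ^+ 2 else 0))%:E)%E.
  by apply: eq_bigr => p _; rewrite expectation_noise_prod -EFinM.
rewrite sumEFin; congr EFin.
rewrite -(pair_bigA _ (fun x y =>
  b x * b y * (if x == y then sigma ^+ 2 else 0)))/= mulr_sumr.
apply: eq_bigr => x _; rewrite (bigD1 x)//= eqxx big1 ?addr0; first by ring.
by move=> y yx; rewrite eq_sym (negbTE yx) mulr0.
Qed.

End WhiteNoise.
End Expectation.

(** * Error of a single mode *)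

Section Modes.
Context {R : realType} {N : nat}.
Variables (lam : nat -> 'I_N -> R) (theta : 'I_N -> R) (sigma : R).

Lemma mode_incrementE (j : nat) (k : 'I_N) :
  mode_increment lam theta sigma j k =
  mode_error lam theta sigma j.+1 k - mode_error lam theta sigma j k.
Proof. by rewrite /mode_increment /mode_error dampingS; ring. Qed.

Variable (n : nat).
Hypothesis lam01 : forall i k, (1 <= i <= n)%N -> 0 <= lam i k <= 1.

Lemma damping_ge0 (j : nat) (k : 'I_N) : (j <= n)%N -> 0 <= damping lam j k.
Proof.
elim: j => [|j IH] jn; first by rewrite /damping big_geq.
have /andP[_ l1] := lam01 j.+1 k jn.
by rewrite dampingS mulr_ge0 ?subr_ge0// IH// ltnW.
Qed.

Lemma damping_nonincreasing (i j : nat) (k : 'I_N) : (i <= j)%N -> (j <= n)%N ->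
  damping lam j k <= damping lam i k.
Proof.
move=> /subnK <-; elim: (j - i)%N => [|m IH] // mn.
apply: le_trans (IH (ltnW mn)); rewrite addSn dampingS.
have /andP[l0 _] := lam01 (m + i).+1 k mn.
by rewrite ler_piMl ?damping_ge0 ?(ltnW mn)// gerBl.
Qed.

Lemma mode_increment_lt0 (j : nat) (k : 'I_N) : (j < n)%N ->
  0 < theta k ^+ 2 + sigma ^+ 2 ->
  (mode_increment lam theta sigma j k < 0 <->
   0 < damping lam j k * lam j.+1 k /\ level_criterion lam theta sigma j k).
Proof.
move=> jn S0; have a0 := damping_ge0 j k (ltnW jn).
have /andP[l0 _] := lam01 j.+1 k jn.
have al0 : 0 <= damping lam j k * lam j.+1 k by rewrite mulr_ge0.
rewrite /mode_increment /level_criterion ltr_pdivrMr//; split.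
  have [->|al] := eqVneq (damping lam j k * lam j.+1 k) 0.
    by rewrite mul0r ltxx.
  have al_gt0 : 0 < damping lam j k * lam j.+1 k by rewrite lt_def al.
  by rewrite pmulr_rlt0// subr_lt0.
by case=> al_gt0 crit; rewrite pmulr_rlt0// subr_lt0.
Qed.

Lemma mode_increment_noiseless (j : nat) (k : 'I_N) : (j < n)%N ->
  sigma = 0 -> mode_increment lam theta sigma j k <= 0.
Proof.
move=> jn s0; have a0 := damping_ge0 j k (ltnW jn).
have /andP[l0 l1] := lam01 j.+1 k jn.
rewrite /mode_increment s0 expr0n/= mulr0 addr0 sub0r mulrN oppr_le0.
have l2 : 0 <= 2 - lam j.+1 k by lra.
apply: mulr_ge0; first exact: mulr_ge0.
by apply: mulr_ge0; [exact: mulr_ge0 | exact: sqr_ge0].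
Qed.

(** A mode damped below [sigma^2 / (theta^2 + sigma^2)] at some level is not
    improved by any later level. *)
Lemma damped_mode (i j : nat) (k : 'I_N) : (i <= j)%N -> (j < n)%N ->
  0 < theta k ^+ 2 + sigma ^+ 2 ->
  damping lam i k < sigma ^+ 2 / (theta k ^+ 2 + sigma ^+ 2) ->
  ~ level_criterion lam theta sigma j k /\
  0 <= mode_increment lam theta sigma j k.
Proof.
move=> ij jn S0; rewrite ltr_pdivlMr// => small.
have a0 := damping_ge0 j k (ltnW jn).
have aij := damping_nonincreasing i j k ij (ltnW jn).
have /andP[l0 l1] := lam01 j.+1 k jn.
have bound : damping lam j k * (2 - lam j.+1 k) * (theta k ^+ 2 + sigma ^+ 2)
    <= 2 * sigma ^+ 2.
  apply: (@le_trans _ _ (damping lam i k * 2 * (theta k ^+ 2 + sigma ^+ 2))).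
    rewrite ler_pM2r// ler_pM// ?subr_ge0 ?(le_trans l1) ?ler1n//.
    by rewrite gerBl.
  by rewrite mulrAC mulrC ler_pM2l// ltW.
split; first by rewrite /level_criterion ltr_pdivrMr// ltNge bound.
by rewrite /mode_increment mulr_ge0 ?mulr_ge0// subr_ge0.
Qed.

End Modes.

(** * Integrated error *)

(** Bias-variance decomposition of the integrated error over the modes. *)
Lemma MISE_mode_error (R : realType) (X : finType) (N n : nat)
    (Q : nat -> 'End(data_space R X)) (f : data_space R X)
    (dT : measure_display) (T : measurableType dT) (P : probability T R)
    (eps : X -> {RV P >-> R}) (sigma : R)
    (eps_mean : forall x : X, ('E_P[eps x] = 0)%E)
    (eps_cov : forall x y : X,
       covariance P (eps x) (eps y) = (if x == y then sigma ^+ 2 else 0)%:E)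
    (u : 'I_N -> data_space R X) (hu : orthonormal_basis u)
    (lam : nat -> 'I_N -> R)
    (Qu : forall (i : nat) (k : 'I_N), (1 <= i <= n)%N ->
       Q i (u k) = lam i k *: u k)
    (theta : 'I_N -> R) (hf : f = \sum_(k < N) theta k *: u k) (j : nat) :
  (j <= n)%N ->
  MISE P Q f eps j = (\sum_k mode_error lam theta sigma j k)%:E.
Proof.
move=> jn; rewrite /MISE.
under eq_bigr => x _.
  under eq_fun => w do
    rewrite {1}hf [X in ms_approx _ _ (noisy_data X _ _)]hf
      (ms_residual Q u lam Qu hu j theta _ _ w x jn).
  rewrite (expectation_affine_sqr P eps sigma eps_mean eps_cov).
  over.
rewrite sumEFin big_split/= -mulr_sumr (parseval u hu).
rewrite (sum_kernel_sqr u hu) mulr_sumr -big_split/=.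
by congr EFin; apply: eq_bigr => k _; rewrite exprMn.
Qed.

Theorem corollary3p7 (R : realType) (d N n : nat)
    (X : {fset 'rV[R]_d}) (hN : #|` X| = N)
    (Q : nat -> 'End(data_space R X)) (f : data_space R X)
    (dT : measure_display) (T : measurableType dT) (P : probability T R)
    (eps : X -> {RV P >-> R}) (sigma : R)
    (eps_mean : forall x : X, ('E_P[eps x] = 0)%E)
    (eps_cov : forall x y : X,
       covariance P (eps x) (eps y) = (if x == y then sigma ^+ 2 else 0)%:E)
    (u : 'I_N -> data_space R X) (hu : orthonormal_basis u)
    (lam : nat -> 'I_N -> R)
    (Qu : forall (i : nat) (k : 'I_N), (1 <= i <= n)%N ->
       Q i (u k) = lam i k *: u k)
    (lam01 : forall (i : nat) (k : 'I_N), (1 <= i <= n)%N -> 0 <= lam i k <= 1)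
    (theta : 'I_N -> R) (hf : f = \sum_(k < N) theta k *: u k) :
  (forall j : nat, (1 <= j < n)%N ->
     [/\ (MISE P Q f eps j.+1 - MISE P Q f eps j)%E =
           (\sum_(k < N) mode_increment lam theta sigma j k)%:E,
         (forall k : 'I_N,
            mode_increment lam theta sigma j k =
            mode_error lam theta sigma j.+1 k - mode_error lam theta sigma j k)
       & (forall k : 'I_N, 0 < theta k ^+ 2 + sigma ^+ 2 ->
            (mode_increment lam theta sigma j k < 0 <->
             0 < damping lam j k * lam j.+1 k /\
             level_criterion lam theta sigma j k))])
  /\
  (sigma = 0 ->
     (forall (j : nat) (k : 'I_N), (1 <= j < n)%N ->
        mode_increment lam theta sigma j k <= 0) /\
     (forall i j : nat, (1 <= i)%N -> (i <= j)%N -> (j <= n)%N ->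
        (MISE P Q f eps j <= MISE P Q f eps i)%E))
  /\
  (forall (j : nat) (k : 'I_N), (1 <= j < n)%N ->
     0 < theta k ^+ 2 + sigma ^+ 2 ->
     damping lam j k < sigma ^+ 2 / (theta k ^+ 2 + sigma ^+ 2) ->
     forall j' : nat, (j <= j')%N -> (j' < n)%N ->
       ~ level_criterion lam theta sigma j' k /\
       0 <= mode_increment lam theta sigma j' k).
Proof.
have ME := MISE_mode_error R X N n Q f dT T P eps sigma eps_mean eps_cov u hu
  lam Qu theta hf.
split; last split.
- move=> j /andP[_ jn]; split.
  + rewrite !ME ?(ltnW jn)// -EFinB -sumrB; congr EFin.
    by apply: eq_bigr => k _; rewrite mode_incrementE.
  + by move=> k; exact: mode_incrementE.
  + by move=> k; apply: (mode_increment_lt0 lam theta sigma n lam01).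
- move=> s0; have dec j k : (j < n)%N -> mode_increment lam theta sigma j k <= 0.
    by move=> jn; exact: (mode_increment_noiseless lam theta sigma n).
  split=> [j k /andP[_ jn]|i j _ /subnK <-]; first exact: dec.
  elim: (j - i)%N => [|m IH] // mn.
  apply: le_trans (IH (ltnW mn)); rewrite addSn in mn *.
  rewrite !ME ?(ltnW mn)// lee_fin ler_sum// => k _.
  by rewrite -subr_le0 -mode_incrementE dec.
- move=> j k _ S0 small j' jj' j'n.
  exact: (damped_mode lam theta sigma n lam01 j j').
Qed.
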